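(* Let $X$ and $Y$ be finite nonempty sets. If $\Delta_{\mathcal R}\colon\mathcal P(\mathcal P(X))^n\to\mathcal P(\mathcal P(Y))$ is a local Kripke-operator, then it weakly preserves dominated convexity.
   Context: A family of sets $\mathcal A$ is convex if $S,T\in\mathcal A$ and $S\subseteq C\subseteq T$ imply $C\in\mathcal A$; it is dominated if $\bigcup\mathcal A\in\mathcal A$. For a relation $\mathcal R\subseteq\mathcal P(Y)\times\mathcal P(X)^n$ ($n$ a positive integer), the Kripke-operator $\Delta_{\mathcal R}\colon\mathcal P(\mathcal P(X))^n\to\mathcal P(\mathcal P(Y))$ is defined by: $B\in\Delta_{\mathcal R}(\mathcal A_0,\ldots,\mathcal A_{n-1})$ iff there are $A_0\in\mathcal A_0,\ldots,A_{n-1}\in\mathcal A_{n-1}$ with $(B,A_0,\ldots,A_{n-1})\in\mathcal R$. Write $\mathcal R[A]=\{(A_0,\ldots,A_{n-1}):(A,A_0,\ldots,A_{n-1})\in\mathcal R\}$. $\Delta_{\mathcal R}$ is local if for every $A\in\mathcal P(Y)$: $(A_0,\ldots,A_{n-1})\in\mathcal R[A]$ iff for each $a\in A$ there is $(A_0^a,\ldots,A_{n-1}^a)\in\mathcal R[\{a\}]$ such that $A_i=\bigcup_{a\in A}A_i^a$ for all $i<n$. $\Delta$ weakly preserves dominated convexity if, whenever every $\mathcal A_i$ ($i<n$) is dominated and convex, $\Delta(\mathcal A_0,\ldots,\mathcal A_{n-1})$ is either dominated and convex, or empty. *)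

(* Defs.v *)
From mathcomp Require Import all_boot.

Set Implicit Arguments.
Unset Strict Implicit.
Unset Printing Implicit Defensive.

Definition set_convex (X : finType) (F : {set {set X}}) : Prop :=
  forall S T C : {set X},
    S \in F -> T \in F -> S \subset C -> C \subset T -> C \in F.

(* [cover F] is the union of the members of [F]; the empty family is not
   dominated. *)
Definition dominated (X : finType) (F : {set {set X}}) : Prop := cover F \in F.

(* [tuples X n] is P(X)^n. *)
Notation tuples X n := {ffun 'I_n -> {set X}}.

(* Subsets of P(Y) x P(X)^n. *)
Notation krel X Y n := {set {set Y} * tuples X n}.

Definition kripke_op (X Y : finType) (n : nat) (R : krel X Y n)
    (F : {ffun 'I_n -> {set {set X}}}) : {set {set Y}} :=
  [set B : {set Y} | [exists A : tuples X n,
     [forall i, A i \in F i] && ((B, A) \in R)]].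

Definition rel_image (X Y : finType) (n : nat) (R : krel X Y n)
    (B : {set Y}) : {set tuples X n} :=
  [set A : tuples X n | (B, A) \in R].

(* The family (f a), a in B, is a total function on Y whose values outside B
   are irrelevant.  Locality is a property of R, which is determined by
   [kripke_op R] (evaluate at tuples of singletons). *)
Definition local (X Y : finType) (n : nat) (R : krel X Y n) : Prop :=
  forall (B : {set Y}) (A : tuples X n),
    A \in rel_image R B <->
    exists f : Y -> tuples X n,
      (forall a, a \in B -> f a \in rel_image R [set a]) /\
      (forall i, A i = \bigcup_(a in B) f a i).

Definition weakly_preserves_dominated_convexity (X Y : finType) (n : nat)
    (Delta : {ffun 'I_n -> {set {set X}}} -> {set {set Y}}) : Prop :=
  forall F : {ffun 'I_n -> {set {set X}}},
    (forall i, dominated (F i) /\ set_convex (F i)) ->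
    (dominated (Delta F) /\ set_convex (Delta F)) \/ Delta F = set0.

(* Main.v *)
Require Import Defs.
From mathcomp Require Import all_boot.

(** The image family [D := kripke_op R F] is upward closed inside its own union:
    if [S \in D] and [S \subset C \subset cover D], then [C \in D]
    ([kripke_op_upward]).  Convexity of [D] follows because every member of [D]
    lies below [cover D], and domination of a nonempty [D] follows by taking
    [C := cover D].

    For the upward closure, locality splits a witness [A] for [S] into pointwise
    witnesses [f a], [a \in S].  Every point [a] of [cover D] lies in some member
    of [D], so it has a pointwise witness as well, with components inside
    [cover (F i)] ([local_point_witness]).  Using [f a] at the points of [S] and
    these other witnesses on [C :\: S], locality glues them to a tuple related
    to [C] whose i-th component lies between [A i] and [cover (F i)]; both belong
    to the convex dominated family [F i], hence so does that component. *)

Lemma kripke_opP (X Y : finType) (n : nat) (R : krel X Y n)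
    (F : {ffun 'I_n -> {set {set X}}}) (B : {set Y}) :
  reflect (exists2 A : tuples X n, forall i, A i \in F i & A \in rel_image R B)
          (B \in kripke_op R F).
Proof.
rewrite inE; apply: (iffP existsP) => [[A /andP[/forallP AF BA]]|[A AF]].
  by exists A; rewrite ?inE.
by rewrite inE => BA; exists A; rewrite BA andbT; apply/forallP.
Qed.

Lemma local_point_witness (X Y : finType) (n : nat) (R : krel X Y n)
    (F : {ffun 'I_n -> {set {set X}}}) (a : Y) :
  local R -> a \in cover (kripke_op R F) ->
  exists2 t : tuples X n, t \in rel_image R [set a]
                        & forall i, t i \subset cover (F i).
Proof.
move=> locR /bigcupP[B /kripke_opP[A AF /locR[f [fR Af]]] aB].
exists (f a) => [|i]; first exact: fR.
apply: (subset_trans (B := A i)); last exact: bigcup_sup (AF i).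
by rewrite Af; apply: (bigcup_sup a).
Qed.

Lemma kripke_op_upward (X Y : finType) (n : nat) (R : krel X Y n)
    (F : {ffun 'I_n -> {set {set X}}}) (S C : {set Y}) :
  local R -> (forall i, dominated (F i) /\ set_convex (F i)) ->
  S \in kripke_op R F -> S \subset C -> C \subset cover (kripke_op R F) ->
  C \in kripke_op R F.
Proof.
move=> locR domcvxF /kripke_opP[A AF /locR[f [fR Af]]] SC Ccov.
have fcov a i : a \in S -> f a i \subset cover (F i).
  move=> aS; apply: (subset_trans (B := A i)); last exact: bigcup_sup (AF i).
  by rewrite Af; apply: (bigcup_sup a).
have /fin_all_exists[h hP] a : exists t : tuples X n, a \in C ->
    [/\ t \in rel_image R [set a], forall i, t i \subset cover (F i)
      & a \in S -> t = f a].
  have [aS|aNS] := boolP (a \in S).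
    by exists (f a) => _; split=> // [|i]; [exact: fR | exact: fcov].
  (* Outside [C] the value is irrelevant; [f a] is a default there. *)
  have [aC|aNC] := boolP (a \in C); last by exists (f a).
  have [t tR tcov] := local_point_witness _ _ _ _ _ a locR (subsetP Ccov _ aC).
  by exists t.
apply/kripke_opP; exists [ffun i => \bigcup_(a in C) h a i] => [i|].
  have [domF cvxF] := domcvxF i.
  rewrite ffunE; apply: cvxF (AF i) domF _ _.
    rewrite Af; apply/bigcupsP => a aS; have aC := subsetP SC _ aS.
    by have [_ _ /(_ aS) <-] := hP a aC; apply: (bigcup_sup a).
  by apply/bigcupsP => a /hP[].
apply/locR; exists h; split=> [a /hP[]//|i]; by rewrite ffunE.
Qed.

Theorem theorem4p16 (X Y : finType) (n : nat) (R : krel X Y n)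
    (X_nonempty : 0 < #|X|) (Y_nonempty : 0 < #|Y|) (n_pos : 0 < n) :
  local R -> weakly_preserves_dominated_convexity (kripke_op R).
Proof.
move=> locR F domcvxF; have [->|[S SD]] := set_0Vmem (kripke_op R F).
  by right.
left; split=> [|S' T C S'D TD S'C CT].
  apply: (kripke_op_upward _ _ _ _ _ S) => //; exact: bigcup_sup SD.
apply: (kripke_op_upward _ _ _ _ _ S') => //.
by apply: subset_trans CT _; apply: bigcup_sup TD.
Qed.
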